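(* Let $\mathcal{S}$ be a complete idempotent semiring equipped with a dual product $\odot$, let $\mathrm{I}\mathcal{S}$ be its semiring of intervals, and let $\mathbf{A}=[\underline A,\overline A]$ and $\mathbf{B}=[\underline B,\overline B]$ be matrices in $\mathrm{I}\mathcal{S}^{n\times n}$. Suppose that for all $\mathbf{X}\in\mathrm{I}\mathcal{S}^{n\times m}$ the equality $$\mathbf{B}_\ast\,\overline{\backslash}_{\odot}\,(\mathbf{A}^\ast\,\overline{\otimes}\,\mathbf{X})=(\mathbf{B}_\ast\,\overline{\backslash}_{\odot}\,\mathbf{A}^\ast)\,\overline{\otimes}\,\mathbf{X}$$ holds. Then the mapping $$\mathbf{P}:\mathrm{I}\mathcal{S}^{n\times m}\to\mathrm{I}\mathcal{S}^{n\times m},\qquad \mathbf{X}\mapsto(\mathbf{B}_\ast\,\overline{\backslash}_{\odot}\,\mathbf{A}^\ast)^\ast\,\overline{\backslash}\,\mathbf{X},$$ with, for $\mathbf X=[\underline X,\overline X]$, $U=\underline{B}_\ast\backslash_{\odot}\underline{A}^\ast$ and $V=\overline{B}_\ast\backslash_{\odot}\overline{A}^\ast$, $$(\mathbf{B}_\ast\,\overline{\backslash}_{\odot}\,\mathbf{A}^\ast)^\ast\,\overline{\backslash}\,\mathbf{X}=\Big[\,\big(U^\ast\backslash\underline{X}\big)\wedge\big((U\oplus V)^\ast\backslash\overline{X}\big),\ (U\oplus V)^\ast\backslash\overline{X}\,\Big],$$ is a projector in $\operatorname{Im}L_{\mathbf{A}^\ast}\cap\operatorname{Im}\Lambda_{\mathbf{B}_\ast}$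 (that is, $\mathbf P\circ\mathbf P=\mathbf P$ and $\mathbf P$ takes values in this set), and formally, for every $\mathbf X\in\mathrm{I}\mathcal{S}^{n\times m}$, $$\mathbf{P}(\mathbf{X})=\bigvee\{\,\mathbf{Y}\in\mathrm{I}\mathcal{S}^{n\times m}:\mathbf{Y}\preceq\mathbf{X}\text{ and }\mathbf{Y}\in\operatorname{Im}L_{\mathbf{A}^\ast}\cap\operatorname{Im}\Lambda_{\mathbf{B}_\ast}\}.$$
   Context: An idempotent semiring is a set $\mathcal{S}$ with operations $\oplus,\otimes$ such that $(\mathcal{S},\oplus,\varepsilon)$ is a commutative monoid with $a\oplus a=a$, $(\mathcal{S},\otimes,e)$ is a monoid, $\otimes$ distributes over $\oplus$, and $\varepsilon$ is absorbing for $\otimes$. It is ordered by $a\succeq b\iff a=a\oplus b$. It is complete if arbitrary sums $\bigoplus$ exist and $\otimes$ distributes over arbitrary sums; then it is a complete lattice with join $\bigoplus$ (also written $\bigvee$), meet $\bigwedge$, bottom $\varepsilon$ and top $\top$. A dual product on $\mathcal{S}$ is an operation $\odot$ such that $(\mathcal{S},\odot,e)$ is a monoid (same neutral element $e$), $\odot$ distributes (on both sides) over arbitrary meets $\bigwedge$, and $\top$ is absorbing: $\top\odot a=a\odot\top=\top$. Semiring of intervals: $\mathrm{I}\mathcal{S}$ is the set of intervals $\mathbf{x}=[\underline{x},\overline{x}]=\{t\in\mathcal{S}:\underline{x}\preceq t\preceq\overline{x}\}$ with $\underline{x}\preceq\overline{x}$ in $\mathcal S$, with $\mathbf{x}\,\overline{\oplus}\,\mathbf{y}=[\underline{x}\oplus\underline{y},\overline{x}\oplus\overline{y}]$,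 $\mathbf{x}\,\overline{\otimes}\,\mathbf{y}=[\underline{x}\otimes\underline{y},\overline{x}\otimes\overline{y}]$ and dual product $\mathbf{x}\,\overline{\odot}\,\mathbf{y}=[\underline{x}\odot\underline{y},\overline{x}\odot\overline{y}]$. Its order is $\mathbf{x}\preceq\mathbf{y}\iff\underline{x}\preceq\underline{y}$ and $\overline{x}\preceq\overline{y}$. Its neutral elements are $[\varepsilon,\varepsilon]$ and $[e,e]$, and its top is $[\top,\top]$. It is a complete idempotent semiring with a dual product. A matrix $\mathbf A$ over $\mathrm{I}\mathcal{S}$ is identified with the pair $[\underline A,\overline A]$ of its matrices of lower and upper bounds. In either $\mathcal{S}$ or $\mathrm{I}\mathcal{S}$, matrices are ordered entrywise; matrix products are $(A\otimes X)_{ij}=\bigoplus_k a_{ik}\otimes x_{kj}$ and $(A\odot X)_{ij}=\bigwedge_k a_{ik}\odot x_{kj}$ (overlined in $\mathrm{I}\mathcal{S}$). Put $L_A(X)=A\otimes X$ and $\Lambda_A(X)=A\odot X$. $A\backslash X$ is the greatest matrix $Y$ with $A\otimes Y\preceq X$, and $A\backslash_{\odot}X$ is the smallest matrix $Y$ with $A\odot Y\succeq X$; both exist, and in $\mathrm{I}\mathcal{S}$ they are written $\overline{\backslash}$ and $\overline{\backslash}_{\odot}$. $E$ is the square matrix with $e$ on the diagonal and $\varepsilon$ elsewhere; $E^\odot$ is the one with $e$ on the diagonal and $\top$ elsewhere (with the corresponding elements of $\mathrm{I}\mathcal{S}$ for interval matrices). $A^\ast=\bigoplus_{k\ge0}A^k$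 with $A^0=E$, $A^k=A\otimes A^{k-1}$; $B_\ast=\bigwedge_{k\ge0}B^{\odot k}$ with $B^{\odot0}=E^\odot$, $B^{\odot k}=B\odot B^{\odot(k-1)}$. For interval matrices these satisfy $\mathbf{A}^\ast=[\underline{A}^\ast,\overline{A}^\ast]$ and $\mathbf{B}_\ast=[\underline{B}_\ast,\overline{B}_\ast]$. $L_{\mathbf A^\ast}$ and $\Lambda_{\mathbf B_\ast}$ are regarded as maps $\mathrm{I}\mathcal{S}^{n\times m}\to\mathrm{I}\mathcal{S}^{n\times m}$, and $\operatorname{Im}$ denotes the image. *)

(* Defs.v *)
(* ssrnum is deliberately not imported: its ordered structures require
   subtraction, and Hierarchy Builder rejects a join of semirings and lattices
   declared after them. *)
From HB Require Import structures.
From mathcomp Require Import all_boot all_order ssralg matrix.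
From mathcomp Require Import boolp classical_sets.

Set Implicit Arguments.
Unset Strict Implicit.
Unset Printing Implicit Defensive.

Import Order.TTheory GRing.Theory.

Local Open Scope classical_set_scope.
Local Open Scope ring_scope.

(* Complete idempotent semirings.  The order is determined by the addition
   (le_addE), and the order and lattice structures exist as soon as the sums
   bigjoin do (factory PzSemiRing_isCompleteDioid below): they are part of the
   structure only to give access to the order library. *)
HB.mixin Record TBLattice_isCompleteDioid (d : Order.disp_t) S
    of GRing.PzSemiRing S & Order.TBLattice d S := {
  bigjoin : set S -> S;
  addxx : forall x : S, x + x = x;
  le_addE : forall x y : S, (x <= y)%O = (y == y + x);
  bigjoinP : forall A : set S, supremums A (bigjoin A);
  mul_bigjoinr : forall (x : S) (A : set S),
    x * bigjoin A = bigjoin [set x * a | a in A];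
  mul_bigjoinl : forall (x : S) (A : set S),
    bigjoin A * x = bigjoin [set a * x | a in A];
}.

#[short(type="completeDioidType")]
HB.structure Definition CompleteDioid (d : Order.disp_t) :=
  { S of GRing.PzSemiRing S & Order.TBLattice d S
       & TBLattice_isCompleteDioid d S }.

HB.factory Record PzSemiRing_isCompleteDioid (d : Order.disp_t) S
    of GRing.PzSemiRing S := {
  bigjoin : set S -> S;
  addxx : forall x : S, x + x = x;
  bigjoin_ub : forall (A : set S) (a : S), A a -> bigjoin A = bigjoin A + a;
  bigjoin_lub : forall (A : set S) (b : S),
    (forall a, A a -> b = b + a) -> b = b + bigjoin A;
  mul_bigjoinr : forall (x : S) (A : set S),
    x * bigjoin A = bigjoin [set x * a | a in A];
  mul_bigjoinl : forall (x : S) (A : set S),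
    bigjoin A * x = bigjoin [set a * x | a in A];
}.

HB.builders Context d S of PzSemiRing_isCompleteDioid d S.

Let le (x y : S) := y == y + x.

Let le_refl : reflexive le.
Proof. by move=> x; rewrite /le addxx. Qed.

Let le_anti : antisymmetric le.
Proof. by move=> x y /andP[/eqP yE /eqP xE]; rewrite xE addrC -yE. Qed.

Let le_trans : transitive le.
Proof.
by move=> y x z /eqP yE /eqP zE; rewrite /le {2}zE -addrA -yE -zE.
Qed.

HB.instance Definition _ :=
  Order.Le_isPOrder.Build d S le_refl le_anti le_trans.

Let bigjoin_ge (A : set S) (x : S) : A x -> (x <= bigjoin A)%O.
Proof. by move=> Ax; apply/eqP/bigjoin_ub. Qed.

Let bigjoin_le (A : set S) (x : S) : (forall a, A a -> (a <= x)%O) ->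
  (bigjoin A <= x)%O.
Proof. by move=> Ax; apply/eqP/bigjoin_lub => a /Ax /eqP. Qed.

Let meet (x y : S) := bigjoin [set z | (z <= x)%O /\ (z <= y)%O].

Let meetP (x y z : S) : (x <= meet y z)%O = (x <= y)%O && (x <= z)%O.
Proof.
apply/idP/andP => [xm|xyz]; last exact: bigjoin_ge.
by split; apply: Order.POrderTheory.le_trans xm _; apply: bigjoin_le => a [].
Qed.

Let joinP (x y z : S) : (x + y <= z)%O = (x <= z)%O && (y <= z)%O.
Proof.
rewrite /Order.le /= /le; apply/eqP/andP => [zE|[/eqP xz /eqP yz]].
  split; apply/eqP; rewrite {2}zE -!addrA; last by rewrite addxx -zE.
  by rewrite [x + (y + x)]addrCA addxx [y + x]addrC -zE.
by rewrite addrA -xz -yz.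
Qed.

HB.instance Definition _ :=
  Order.POrder_MeetJoin_isLattice.Build d S meetP joinP.

Let le0x (x : S) : ((0 : S) <= x)%O.
Proof. by rewrite /Order.le /= /le addr0. Qed.

Let lex1 (x : S) : (x <= bigjoin setT)%O. Proof. exact: bigjoin_ge. Qed.

HB.instance Definition _ := Order.hasBottom.Build d S le0x.
HB.instance Definition _ := Order.hasTop.Build d S lex1.

Let le_addE (x y : S) : (x <= y)%O = (y == y + x). Proof. by []. Qed.

Let bigjoinP (A : set S) : supremums A (bigjoin A).
Proof.
by split=> [x /bigjoin_ge//|x xA]; apply: bigjoin_le => a /xA.
Qed.

HB.instance Definition _ := TBLattice_isCompleteDioid.Build d S
  addxx le_addE bigjoinP mul_bigjoinr mul_bigjoinl.

HB.end.

Definition bigmeet d (S : completeDioidType d) (A : set S) : S :=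
  bigjoin (lbound A).

Section CompleteDioidTheory.
Variables (d : Order.disp_t) (S : completeDioidType d).
Implicit Types (x y : S) (A : set S).

Lemma le_bigjoin A x : A x -> (x <= bigjoin A)%O.
Proof. by move=> Ax; apply: (bigjoinP A).1. Qed.

Lemma bigjoin_le A x : (forall a, A a -> (a <= x)%O) -> (bigjoin A <= x)%O.
Proof. by move=> Ax; apply: (bigjoinP A).2. Qed.

Lemma bigmeet_le A x : A x -> (bigmeet A <= x)%O.
Proof. by move=> Ax; apply: bigjoin_le => a; apply. Qed.

Lemma le_bigmeet A x : (forall a, A a -> (x <= a)%O) -> (x <= bigmeet A)%O.
Proof. by move=> Ax; apply: le_bigjoin. Qed.

Lemma bigmeetP A : infimums A (bigmeet A).
Proof. by split=> [x /bigmeet_le|x xA]//; apply: le_bigmeet. Qed.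

Lemma le_add x y z : (x + y <= z)%O = (x <= z)%O && (y <= z)%O.
Proof.
rewrite !le_addE; apply/eqP/andP => [zE|[/eqP xz /eqP yz]].
  split; apply/eqP; rewrite {2}zE -!addrA; last by rewrite addxx -zE.
  by rewrite [x + (y + x)]addrCA addxx [y + x]addrC -zE.
by rewrite addrA -xz -yz.
Qed.

Lemma joinE x y : (x `|` y)%O = x + y.
Proof.
apply/le_anti; rewrite leUx le_add leUl leUr.
by have := lexx (x + y); rewrite le_add => /andP[-> ->].
Qed.

Lemma botE : (\bot)%O = 0 :> S.
Proof. by apply/le_anti; rewrite le0x /= le_addE addr0. Qed.

Lemma le_sum n (F : 'I_n -> S) x :
  (\sum_i F i <= x)%O <-> (forall i, (F i <= x)%O).
Proof.
elim: n F => [|n IH] F.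
  by rewrite big_ord0 -botE le0x; split=> // _ [].
rewrite big_ord_recl le_add; split=> [/andP[F0 /IH Fi] i|Fx].
  by case: (unliftP ord0 i) => [j|] ->.
by apply/andP; split; [|apply/IH].
Qed.

End CompleteDioidTheory.

(* dmulTx and dmulxT are the instances A := set0 of the distributivity laws.
   The unit of the dual product is the unit 1 of the semiring. *)
HB.mixin Record CompleteDioid_hasDualProduct (d : Order.disp_t) S
    of CompleteDioid d S := {
  dmul : S -> S -> S;
  dmulA : associative dmul;
  dmul1x : left_id 1 dmul;
  dmulx1 : right_id 1 dmul;
  dmul_bigmeetr : forall (x : S) (A : set S),
    dmul x (bigmeet A) = bigmeet [set dmul x a | a in A];
  dmul_bigmeetl : forall (x : S) (A : set S),
    dmul (bigmeet A) x = bigmeet [set dmul a x | a in A];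
  dmulTx : left_zero \top%O dmul;
  dmulxT : right_zero \top%O dmul;
}.

#[short(type="dualDioidType")]
HB.structure Definition DualDioid (d : Order.disp_t) :=
  { S of CompleteDioid d S & CompleteDioid_hasDualProduct d S }.

(* An interval [lo, hi] is nonempty, hence determined by its pair of bounds. *)
Record ivl d (S : completeDioidType d) := Ivl {
  bounds : S * S;
  bounds_le : (bounds.1 <= bounds.2)%O
}.

HB.instance Definition _ d (S : completeDioidType d) :=
  [isSub for @bounds d S].
HB.instance Definition _ d (S : completeDioidType d) :=
  [Choice of ivl S by <:].

Definition lo d (S : completeDioidType d) (x : ivl S) : S := (bounds x).1.
Definition hi d (S : completeDioidType d) (x : ivl S) : S := (bounds x).2.

Section IntervalDioid.
Variables (d : Order.disp_t) (S : completeDioidType d).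
Implicit Types (x y z : ivl S) (A : set (ivl S)).

Lemma lo_le_hi x : (lo x <= hi x)%O. Proof. exact: bounds_le. Qed.

Lemma ivlP x y : lo x = lo y -> hi x = hi y -> x = y.
Proof.
case: x y => [[a b] ab] [[a' b'] ab']; rewrite /lo /hi /= => ea eb.
by apply: val_inj; rewrite /= ea eb.
Qed.

Lemma mul_le (a b a' b' : S) :
  (a <= a')%O -> (b <= b')%O -> (a * b <= a' * b')%O.
Proof.
rewrite !le_addE => /eqP aE /eqP bE; apply/eqP.
by rewrite aE bE !mulrDl !mulrDr !addrA -[RHS]addrA addxx.
Qed.

Lemma add_le (a b a' b' : S) :
  (a <= a')%O -> (b <= b')%O -> (a + b <= a' + b')%O.
Proof.
by move=> ab ab'; rewrite -!joinE leU2.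
Qed.

Definition ivl_add x y : ivl S :=
  @Ivl d S (lo x + lo y, hi x + hi y) (add_le (lo_le_hi x) (lo_le_hi y)).
Definition ivl_mul x y : ivl S :=
  @Ivl d S (lo x * lo y, hi x * hi y) (mul_le (lo_le_hi x) (lo_le_hi y)).
Definition ivl_const (a : S) : ivl S := @Ivl d S (a, a) (lexx a).

Fact ivl_addA : associative ivl_add.
Proof. by move=> x y z; apply: ivlP; rewrite /lo /hi /= addrA. Qed.
Fact ivl_addC : commutative ivl_add.
Proof. by move=> x y; apply: ivlP; rewrite /lo /hi /= addrC. Qed.
Fact ivl_add0 : left_id (ivl_const 0) ivl_add.
Proof. by move=> x; apply: ivlP; rewrite /lo /hi /= add0r. Qed.
Fact ivl_mulA : associative ivl_mul.
Proof. by move=> x y z; apply: ivlP; rewrite /lo /hi /= mulrA. Qed.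
Fact ivl_mul1x : left_id (ivl_const 1) ivl_mul.
Proof. by move=> x; apply: ivlP; rewrite /lo /hi /= mul1r. Qed.
Fact ivl_mulx1 : right_id (ivl_const 1) ivl_mul.
Proof. by move=> x; apply: ivlP; rewrite /lo /hi /= mulr1. Qed.
Fact ivl_mulDl : left_distributive ivl_mul ivl_add.
Proof. by move=> x y z; apply: ivlP; rewrite /lo /hi /= mulrDl. Qed.
Fact ivl_mulDr : right_distributive ivl_mul ivl_add.
Proof. by move=> x y z; apply: ivlP; rewrite /lo /hi /= mulrDr. Qed.
Fact ivl_mul0x : left_zero (ivl_const 0) ivl_mul.
Proof. by move=> x; apply: ivlP; rewrite /lo /hi /= mul0r. Qed.
Fact ivl_mulx0 : right_zero (ivl_const 0) ivl_mul.
Proof. by move=> x; apply: ivlP; rewrite /lo /hi /= mulr0. Qed.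

HB.instance Definition _ := GRing.isPzSemiRing.Build (ivl S)
  ivl_addA ivl_addC ivl_add0 ivl_mulA ivl_mul1x ivl_mulx1
  ivl_mulDl ivl_mulDr ivl_mul0x ivl_mulx0.

Lemma bigjoin_lo_hi A :
  (bigjoin [set lo x | x in A] <= bigjoin [set hi x | x in A])%O.
Proof.
apply: bigjoin_le => _ [x Ax <-]; apply: le_trans (lo_le_hi x) _.
by apply: le_bigjoin; exists x.
Qed.

Definition ivl_bigjoin A : ivl S :=
  @Ivl d S (bigjoin [set lo x | x in A], bigjoin [set hi x | x in A])
    (bigjoin_lo_hi A).

Fact ivl_addxx x : x + x = x.
Proof. by apply: ivlP; rewrite /lo /hi /= addxx. Qed.

Fact ivl_bigjoin_ub A x : A x -> ivl_bigjoin A = ivl_bigjoin A + x.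
Proof.
move=> Ax; apply: ivlP; rewrite /lo /hi /=; apply/eqP; rewrite -le_addE;
  by apply: le_bigjoin; exists x.
Qed.

Fact ivl_bigjoin_lub A y :
  (forall x, A x -> y = y + x) -> y = y + ivl_bigjoin A.
Proof.
move=> Ay; apply: ivlP; rewrite /lo /hi /=; apply/eqP; rewrite -le_addE;
  by apply: bigjoin_le => _ [x /Ay yE <-]; rewrite le_addE {1}yE.
Qed.

Fact ivl_mul_bigjoinr x A :
  x * ivl_bigjoin A = ivl_bigjoin [set x * a | a in A].
Proof.
by apply: ivlP; rewrite /lo /hi /= mul_bigjoinr; congr bigjoin;
  rewrite !image_comp.
Qed.

Fact ivl_mul_bigjoinl x A :
  ivl_bigjoin A * x = ivl_bigjoin [set a * x | a in A].
Proof.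
by apply: ivlP; rewrite /lo /hi /= mul_bigjoinl; congr bigjoin;
  rewrite !image_comp.
Qed.

HB.instance Definition _ := PzSemiRing_isCompleteDioid.Build d (ivl S)
  ivl_addxx ivl_bigjoin_ub ivl_bigjoin_lub
  ivl_mul_bigjoinr ivl_mul_bigjoinl.

Lemma le_ivlE x y : (x <= y)%O = (lo x <= lo y)%O && (hi x <= hi y)%O.
Proof.
rewrite !le_addE; apply/eqP/andP => [yE|[/eqP ? /eqP ?]]; last exact: ivlP.
by split; apply/eqP; rewrite {1}yE.
Qed.

Lemma bounds_bigmeet A :
  bounds (bigmeet A) =
  (bigmeet [set lo x | x in A], bigmeet [set hi x | x in A]).
Proof.
have lh : (bigmeet [set lo x | x in A] <= bigmeet [set hi x | x in A])%O.
  apply: le_bigmeet => _ [x Ax <-]; apply: le_trans (lo_le_hi x).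
  by apply: bigmeet_le; exists x.
suff -> : bigmeet A = @Ivl d S (_, _) lh by [].
apply/le_anti/andP; split.
  rewrite le_ivlE; apply/andP; split; apply: le_bigmeet => _ [x Ax <-];
    by have := bigmeet_le Ax; rewrite le_ivlE => /andP[].
apply: le_bigmeet => x Ax; rewrite le_ivlE.
by apply/andP; split; apply: bigmeet_le; exists x.
Qed.

Lemma lo_bigmeet A : lo (bigmeet A) = bigmeet [set lo x | x in A].
Proof. by rewrite {1}/lo bounds_bigmeet. Qed.

Lemma hi_bigmeet A : hi (bigmeet A) = bigmeet [set hi x | x in A].
Proof. by rewrite {1}/hi bounds_bigmeet. Qed.

Lemma bounds_top : bounds (\top%O : ivl S) = (\top%O, \top%O).
Proof.
suff -> : \top%O = ivl_const \top%O by [].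
by apply/le_anti; rewrite lex1 le_ivlE !lex1.
Qed.

Lemma lo_top : lo \top%O = \top%O :> S.
Proof. by rewrite /lo bounds_top. Qed.

Lemma hi_top : hi \top%O = \top%O :> S.
Proof. by rewrite /hi bounds_top. Qed.

End IntervalDioid.

Section IntervalDualProduct.
Variables (d : Order.disp_t) (S : dualDioidType d).
Implicit Types (x y z : ivl S) (A : set (ivl S)).

Lemma bigmeet2 (a b : S) : (a <= b)%O -> bigmeet [set a; b] = a.
Proof.
move=> ab; apply/le_anti/andP; split; first by apply: bigmeet_le; left.
by apply: le_bigmeet => _ [] ->.
Qed.

Lemma dmul_le (a b a' b' : S) :
  (a <= a')%O -> (b <= b')%O -> (dmul a b <= dmul a' b')%O.
Proof.
move=> aa' bb'; apply: (@le_trans _ _ (dmul a b')).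
  rewrite -(bigmeet2 bb') dmul_bigmeetr; apply: bigmeet_le.
  by exists b' => //; right.
rewrite -(bigmeet2 aa') dmul_bigmeetl; apply: bigmeet_le.
by exists a' => //; right.
Qed.

Definition ivl_dmul x y : ivl S :=
  @Ivl d S (dmul (lo x) (lo y), dmul (hi x) (hi y))
    (dmul_le (lo_le_hi x) (lo_le_hi y)).

Fact ivl_dmulA : associative ivl_dmul.
Proof. by move=> x y z; apply: ivlP; rewrite /lo /hi /= dmulA. Qed.
Fact ivl_dmul1x : left_id 1 ivl_dmul.
Proof. by move=> x; apply: ivlP; rewrite /lo /hi /= dmul1x. Qed.
Fact ivl_dmulx1 : right_id 1 ivl_dmul.
Proof. by move=> x; apply: ivlP; rewrite /lo /hi /= dmulx1. Qed.

Fact ivl_dmul_bigmeetr x A :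
  ivl_dmul x (bigmeet A) = bigmeet [set ivl_dmul x a | a in A].
Proof.
apply: ivlP.
  by rewrite lo_bigmeet {1}/lo /= lo_bigmeet dmul_bigmeetr !image_comp.
by rewrite hi_bigmeet {1}/hi /= hi_bigmeet dmul_bigmeetr !image_comp.
Qed.

Fact ivl_dmul_bigmeetl x A :
  ivl_dmul (bigmeet A) x = bigmeet [set ivl_dmul a x | a in A].
Proof.
apply: ivlP.
  by rewrite lo_bigmeet {1}/lo /= lo_bigmeet dmul_bigmeetl !image_comp.
by rewrite hi_bigmeet {1}/hi /= hi_bigmeet dmul_bigmeetl !image_comp.
Qed.

Fact ivl_dmulTx : left_zero \top%O ivl_dmul.
Proof.
move=> x; apply: ivlP.
  by rewrite lo_top {1}/lo [LHS]/= lo_top dmulTx.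
by rewrite hi_top {1}/hi [LHS]/= hi_top dmulTx.
Qed.
Fact ivl_dmulxT : right_zero \top%O ivl_dmul.
Proof.
move=> x; apply: ivlP.
  by rewrite lo_top {1}/lo [LHS]/= lo_top dmulxT.
by rewrite hi_top {1}/hi [LHS]/= hi_top dmulxT.
Qed.

HB.instance Definition _ := CompleteDioid_hasDualProduct.Build d (ivl S)
  ivl_dmulA ivl_dmul1x ivl_dmulx1 ivl_dmul_bigmeetr ivl_dmul_bigmeetl
  ivl_dmulTx ivl_dmulxT.

End IntervalDualProduct.

Section MatrixOrder.
Variables (d : Order.disp_t) (S : completeDioidType d).

Definition lemx n m (X Y : 'M[S]_(n, m)) : Prop :=
  forall i j, (X i j <= Y i j)%O.

Definition mxjoin n m (F : set 'M[S]_(n, m)) : 'M[S]_(n, m) :=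
  \matrix_(i, j) bigjoin [set X i j | X in F].

Definition mxmeet n m (F : set 'M[S]_(n, m)) : 'M[S]_(n, m) :=
  \matrix_(i, j) bigmeet [set X i j | X in F].

Definition meetmx n m (X Y : 'M[S]_(n, m)) : 'M[S]_(n, m) :=
  map2_mx (@Order.meet d S) X Y.

(* The residual A \ X: greatest Y with A *m Y <= X (see ldivmxP). *)
Definition ldivmx n p m (A : 'M[S]_(n, p)) (X : 'M[S]_(n, m)) :
    'M[S]_(p, m) :=
  mxjoin [set Y | lemx (A *m Y) X].

Definition starmx n (A : 'M[S]_n) : 'M[S]_n :=
  mxjoin (range (fun k => A ^+ k)).

Lemma mxjoin_ge n m (F : set 'M[S]_(n, m)) X : F X -> lemx X (mxjoin F).
Proof. by move=> FX i j; rewrite mxE; apply: le_bigjoin; exists X. Qed.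

Lemma mxjoin_le n m (F : set 'M[S]_(n, m)) Y :
  (forall X, F X -> lemx X Y) -> lemx (mxjoin F) Y.
Proof.
by move=> FY i j; rewrite mxE; apply: bigjoin_le => _ [X /FY XY <-].
Qed.

Lemma mxmeet_le n m (F : set 'M[S]_(n, m)) X : F X -> lemx (mxmeet F) X.
Proof. by move=> FX i j; rewrite mxE; apply: bigmeet_le; exists X. Qed.

Lemma mxmeet_ge n m (F : set 'M[S]_(n, m)) Y :
  (forall X, F X -> lemx Y X) -> lemx Y (mxmeet F).
Proof.
by move=> FY i j; rewrite mxE; apply: le_bigmeet => _ [X /FY XY <-].
Qed.

Lemma ldivmxP n p m (A : 'M[S]_(n, p)) (X : 'M[S]_(n, m)) Y :
  lemx (A *m Y) X <-> lemx Y (ldivmx A X).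
Proof.
split=> [AYX|YX i j]; first exact: mxjoin_ge.
rewrite mxE; apply/le_sum => k.
apply: le_trans (mul_le (lexx _) (YX k j)) _.
rewrite mxE mul_bigjoinr; apply: bigjoin_le => _ [_ [Z AZ <-] <-].
by apply: le_trans (AZ i j); rewrite mxE; apply: (le_sum _ _).1 (lexx _) k.
Qed.

End MatrixOrder.

Section MatrixDualProduct.
Variables (d : Order.disp_t) (S : dualDioidType d).

Definition dmulmx n p m (A : 'M[S]_(n, p)) (X : 'M[S]_(p, m)) :
    'M[S]_(n, m) :=
  \matrix_(i, j) (\meet_(k < p) dmul (A i k) (X k j))%O.

Definition did_mx n : 'M[S]_n :=
  \matrix_(i, j) (if i == j then 1 else \top%O).

(* The dual residual: smallest Y with X <= dmulmx A Y (see dldivmxP). *)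
Definition dldivmx n p m (A : 'M[S]_(n, p)) (X : 'M[S]_(n, m)) :
    'M[S]_(p, m) :=
  mxmeet [set Y | lemx X (dmulmx A Y)].

Definition dexpmx n (B : 'M[S]_n) (k : nat) : 'M[S]_n :=
  iter k (dmulmx B) (did_mx n).

Definition dstarmx n (B : 'M[S]_n) : 'M[S]_n :=
  mxmeet (range (dexpmx B)).

Lemma dldivmxP n p m (A : 'M[S]_(n, p)) (X : 'M[S]_(n, m)) Y :
  lemx X (dmulmx A Y) <-> lemx (dldivmx A X) Y.
Proof.
split=> [XAY|XY i j]; first exact: mxmeet_le.
rewrite mxE; apply/meetsP => k _.
apply: le_trans (dmul_le (lexx _) (XY k j)).
rewrite mxE dmul_bigmeetr; apply: le_bigmeet => _ [_ [Z AZ <-] <-].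
by apply: le_trans (AZ i j) _; rewrite mxE; apply: meets_inf.
Qed.

End MatrixDualProduct.

Definition lomx d (S : completeDioidType d) n m (X : 'M[ivl S]_(n, m)) :
  'M[S]_(n, m) := map_mx (@lo d S) X.
Definition himx d (S : completeDioidType d) n m (X : 'M[ivl S]_(n, m)) :
  'M[S]_(n, m) := map_mx (@hi d S) X.

(* Main.v *)
(* Write M for the dual residual of A^* by B_*.  By the hypothesis, M Y <= Y
   says A^* Y <= B_* o Y.  Since B_* o Y <= Y <= A^* Y, this means that Y is
   fixed by both A^* and B_* o -, i.e. lies in the two images.  The greatest
   solution of M Y <= Y below X is the residual M^* \ X.  The bounds of
   interval residuals come from comparing the Galois connections bound by
   bound; the bounds of M are U and U + V because an upper bound must also
   dominate the lower one. *)
Require Import Defs.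
From mathcomp Require Import all_boot all_order ssralg matrix.
From mathcomp Require Import boolp classical_sets.

Set Implicit Arguments.
Unset Strict Implicit.
Unset Printing Implicit Defensive.

Import Order.TTheory GRing.Theory.

Local Open Scope classical_set_scope.
Local Open Scope ring_scope.

(** * Matrix order, products and the star *)

Section MatrixOrderTheory.
Variables (d : Order.disp_t) (S : completeDioidType d).

Lemma lemx_refl n m (X : 'M[S]_(n, m)) : lemx X X.
Proof. by move=> i j; apply: lexx. Qed.

Lemma lemx_trans n m (Y X Z : 'M[S]_(n, m)) :
  lemx X Y -> lemx Y Z -> lemx X Z.
Proof. by move=> XY YZ i j; apply: le_trans (XY i j) (YZ i j). Qed.

Lemma lemx_anti n m (X Y : 'M[S]_(n, m)) : lemx X Y -> lemx Y X -> X = Y.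
Proof. by move=> XY YX; apply/matrixP => i j; apply/le_anti; rewrite XY YX. Qed.

Lemma lemx_add n m (X Y Z : 'M[S]_(n, m)) :
  lemx (X + Y) Z <-> lemx X Z /\ lemx Y Z.
Proof.
split=> [XYZ|[XZ YZ] i j]; last by rewrite mxE le_add XZ YZ.
by split=> i j; have := XYZ i j; rewrite mxE le_add => /andP[].
Qed.

Lemma lemx_meet n m (X Y Z : 'M[S]_(n, m)) :
  lemx Z (meetmx X Y) <-> lemx Z X /\ lemx Z Y.
Proof.
split=> [ZXY|[ZX ZY] i j]; last by rewrite mxE lexI ZX ZY.
by split=> i j; have := ZXY i j; rewrite mxE lexI => /andP[].
Qed.

Lemma le_mulmx n p m (A A' : 'M[S]_(n, p)) (X X' : 'M[S]_(p, m)) :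
  lemx A A' -> lemx X X' -> lemx (A *m X) (A' *m X').
Proof.
move=> AA' XX' i j; rewrite !mxE; apply/le_sum => k.
apply: le_trans (mul_le (AA' i k) (XX' k j)) _.
exact: (le_sum (fun k => A' i k * X' k j) _).1 (lexx _) k.
Qed.

(** An entry of the product is a finite sum; in each summand [mul_bigjoinl] moves the join outwards,
    and a single summand is at most the whole entry of [A *m X]. *)
Lemma mulmx_mxjoinl_le n p m (F : set 'M[S]_(n, p)) (X : 'M[S]_(p, m)) Y :
  (forall A, F A -> lemx (A *m X) Y) -> lemx (mxjoin F *m X) Y.
Proof.
move=> FXY i j; rewrite mxE; apply/le_sum => k.
rewrite mxE mul_bigjoinl; apply: bigjoin_le => _ [_ [A FA <-] <-].
apply: le_trans (FXY A FA i j); rewrite mxE.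
exact: (le_sum (fun k => A i k * X k j) _).1 (lexx _) k.
Qed.

Lemma expmx_le_star n (A : 'M[S]_n) k : lemx (A ^+ k) (starmx A).
Proof. by apply: mxjoin_ge; exists k. Qed.

Lemma le_star_mulmx n m (A : 'M[S]_n) (X : 'M[S]_(n, m)) :
  lemx X (starmx A *m X).
Proof.
rewrite -{1}[X]mul1mx.
by apply: le_mulmx (@lemx_refl _ _ _); exact: (expmx_le_star A 0).
Qed.

Lemma mulmx_le_star n m (A : 'M[S]_n) (X : 'M[S]_(n, m)) :
  lemx (A *m X) (starmx A *m X).
Proof. by apply: le_mulmx (@lemx_refl _ _ _); exact: (expmx_le_star A 1). Qed.

(** By induction on [k], every power of [A] also maps [X] below [X], hence so does their join. *)
Lemma star_mulmx_le n m (A : 'M[S]_n) (X : 'M[S]_(n, m)) :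
  lemx (A *m X) X -> lemx (starmx A *m X) X.
Proof.
move=> AX; apply: mulmx_mxjoinl_le => _ [k _ <-].
elim: k => [|k IH]; first by rewrite expr0 mul1mx; apply: lemx_refl.
rewrite exprS -[_ * _]/(_ *m _) -mulmxA; apply: lemx_trans AX.
exact: le_mulmx (@lemx_refl _ _ _) IH.
Qed.

Lemma star_mulmx_idem n m (A : 'M[S]_n) (X : 'M[S]_(n, m)) :
  starmx A *m (starmx A *m X) = starmx A *m X.
Proof.
apply: lemx_anti (le_star_mulmx A _); apply: star_mulmx_le.
(* The join must be the leftmost factor to be split into powers, so the residual first carries [A]
   to the right-hand side and takes it back for each power. *)
apply/ldivmxP/mulmx_mxjoinl_le => _ [k _ <-]; apply/(ldivmxP A).
rewrite mulmxA -[A *m _]/(A * _) -exprS.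
exact: le_mulmx (expmx_le_star A k.+1) (@lemx_refl _ _ _).
Qed.

(** Multiplication by [starmx A] is extensive and idempotent, a closure operator, so its image
    consists of the points it does not increase. *)
Lemma range_starmxE n m (A : 'M[S]_n) (Y : 'M[S]_(n, m)) :
  range (fun X : 'M[S]_(n, m) => starmx A *m X) Y <-> lemx (starmx A *m Y) Y.
Proof.
split=> [[X _ <-]|AY]; first by rewrite star_mulmx_idem; apply: lemx_refl.
by exists Y => //; apply: lemx_anti AY (le_star_mulmx A Y).
Qed.

End MatrixOrderTheory.

(** * Dual product and dual star *)

Section DualMatrixTheory.
Variables (d : Order.disp_t) (S : dualDioidType d).

(** Links the finite meets in [dmulmx] to the arbitrary meets over which [dmul] distributes, the
    empty one included. *)
Lemma meets_bigmeet n (F : 'I_n -> S) :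
  (\meet_i F i)%O = bigmeet (range F).
Proof.
apply/le_anti/andP; split.
  by apply: le_bigmeet => _ [i _ <-]; apply: meets_inf.
by apply/meetsP => i _; apply: bigmeet_le; exists i.
Qed.

Lemma dmul_meetsr n (x : S) (F : 'I_n -> S) :
  dmul x (\meet_i F i)%O = (\meet_i dmul x (F i))%O.
Proof. by rewrite !meets_bigmeet dmul_bigmeetr image_comp. Qed.

Lemma dmul_meetsl n (x : S) (F : 'I_n -> S) :
  dmul (\meet_i F i)%O x = (\meet_i dmul (F i) x)%O.
Proof. by rewrite !meets_bigmeet dmul_bigmeetl image_comp. Qed.

Lemma dmulmxA n p q m (A : 'M[S]_(n, p)) (B : 'M[S]_(p, q))
    (C : 'M[S]_(q, m)) :
  dmulmx A (dmulmx B C) = dmulmx (dmulmx A B) C.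
Proof.
apply/matrixP => i j; rewrite !mxE.
under eq_bigr do rewrite mxE dmul_meetsr.
under [RHS]eq_bigr do rewrite mxE dmul_meetsl.
by rewrite exchange_big; do 2!apply: eq_bigr => ? _; rewrite dmulA.
Qed.

Lemma ddmul1mx n m (X : 'M[S]_(n, m)) : dmulmx (did_mx S n) X = X.
Proof.
apply/matrixP => i j; rewrite !mxE (bigD1 i)//= mxE eqxx dmul1x.
by rewrite big1 ?meetx1// => k /negPf ki; rewrite mxE eq_sym ki dmulTx.
Qed.

Lemma le_dmulmx n p m (A A' : 'M[S]_(n, p)) (X X' : 'M[S]_(p, m)) :
  lemx A A' -> lemx X X' -> lemx (dmulmx A X) (dmulmx A' X').
Proof.
move=> AA' XX' i j; rewrite !mxE; apply/meetsP => k _.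
by apply: le_trans (dmul_le (AA' i k) (XX' k j)); apply: meets_inf.
Qed.

Lemma le_dmulmx_mxmeetl n p m (F : set 'M[S]_(n, p)) (X : 'M[S]_(p, m)) Y :
  (forall A, F A -> lemx Y (dmulmx A X)) -> lemx Y (dmulmx (mxmeet F) X).
Proof.
move=> FXY i j; rewrite mxE; apply/meetsP => k _.
rewrite mxE dmul_bigmeetl; apply: le_bigmeet => _ [_ [A FA <-] <-].
by apply: le_trans (FXY A FA i j) _; rewrite mxE; apply: meets_inf.
Qed.

Lemma dstar_le_dexpmx n (B : 'M[S]_n) k : lemx (dstarmx B) (dexpmx B k).
Proof. by apply: mxmeet_le; exists k. Qed.

Lemma dstar_dmulmx_le n m (B : 'M[S]_n) (X : 'M[S]_(n, m)) :
  lemx (dmulmx (dstarmx B) X) X.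
Proof.
rewrite -{2}[X]ddmul1mx.
by apply: le_dmulmx (@lemx_refl _ _ _ _ _); exact: (dstar_le_dexpmx B 0).
Qed.

Lemma le_dstar_dmulmx n m (B : 'M[S]_n) (X : 'M[S]_(n, m)) :
  lemx X (dmulmx B X) -> lemx X (dmulmx (dstarmx B) X).
Proof.
move=> XB; apply: le_dmulmx_mxmeetl => _ [k _ <-].
elim: k => [|k IH]; first by rewrite ddmul1mx; apply: lemx_refl.
rewrite /dexpmx iterS -dmulmxA; apply: lemx_trans XB _.
exact: le_dmulmx (@lemx_refl _ _ _ _ _) IH.
Qed.

Lemma dstar_dmulmx_idem n m (B : 'M[S]_n) (X : 'M[S]_(n, m)) :
  dmulmx (dstarmx B) (dmulmx (dstarmx B) X) = dmulmx (dstarmx B) X.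
Proof.
apply: lemx_anti (dstar_dmulmx_le B _) _; apply: le_dstar_dmulmx.
(* The dual residual sets [B] aside, so that the meet of the powers becomes the leftmost factor. *)
apply/dldivmxP/le_dmulmx_mxmeetl => _ [k _ <-]; apply/(dldivmxP B).
rewrite dmulmxA -/(dexpmx B k.+1).
exact: le_dmulmx (dstar_le_dexpmx B k.+1) (@lemx_refl _ _ _ _ _).
Qed.

(** Dually, the product by [dstarmx B] is contractive and idempotent, so its image consists of the
    points it does not decrease. *)
Lemma range_dstarmxE n m (B : 'M[S]_n) (Y : 'M[S]_(n, m)) :
  range (fun X : 'M[S]_(n, m) => dmulmx (dstarmx B) X) Y <->
  lemx Y (dmulmx (dstarmx B) Y).
Proof.
split=> [[X _ <-]|YB]; first by rewrite dstar_dmulmx_idem; apply: lemx_refl.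
by exists Y => //; apply: lemx_anti (dstar_dmulmx_le B Y) YB.
Qed.

(** The residual is taken of the whole product [starmx A *m Y]: this is the left-hand side of the
    equality assumed in the theorem. *)
Lemma dldivmx_star_leE n m (A B : 'M[S]_n) (Y : 'M[S]_(n, m)) :
  lemx (dldivmx (dstarmx B) (starmx A *m Y)) Y <->
  lemx (starmx A *m Y) Y /\ lemx Y (dmulmx (dstarmx B) Y).
Proof.
rewrite -dldivmxP; split=> [AYB|[AY YB]]; last exact: lemx_trans AY YB.
by split; [apply: lemx_trans AYB (dstar_dmulmx_le B Y)
          |apply: lemx_trans (le_star_mulmx A Y) AYB].
Qed.

End DualMatrixTheory.

(** * The residual by a star as an interior operator *)

Section ResidualOfStar.
Variables (d : Order.disp_t) (S : completeDioidType d) (n m : nat).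
Implicit Types (M : 'M[S]_n) (X Y : 'M[S]_(n, m)).

Lemma ldivmx_star_le M X : lemx (ldivmx (starmx M) X) X.
Proof.
apply: lemx_trans (le_star_mulmx M _) _.
by apply/ldivmxP; apply: lemx_refl.
Qed.

(** By adjunction it suffices that two factors [starmx M] in front of the residual stay below [X];
    idempotence merges them into one. *)
Lemma star_mulmx_ldivmx_le M X :
  lemx (starmx M *m ldivmx (starmx M) X) (ldivmx (starmx M) X).
Proof.
by apply: (ldivmxP _ _ _).1; rewrite star_mulmx_idem; apply/ldivmxP/lemx_refl.
Qed.

Lemma mulmx_ldivmx_star_le M X :
  lemx (M *m ldivmx (starmx M) X) (ldivmx (starmx M) X).
Proof. exact: lemx_trans (mulmx_le_star M _) (star_mulmx_ldivmx_le M X). Qed.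

Lemma le_ldivmx_star M X Y :
  lemx Y X -> lemx (M *m Y) Y -> lemx Y (ldivmx (starmx M) X).
Proof.
by move=> YX MY; apply/ldivmxP; apply: lemx_trans YX; apply: star_mulmx_le.
Qed.

Lemma ldivmx_star_idem M X :
  ldivmx (starmx M) (ldivmx (starmx M) X) = ldivmx (starmx M) X.
Proof.
apply: lemx_anti (ldivmx_star_le M _) _.
exact: le_ldivmx_star (lemx_refl _) (mulmx_ldivmx_star_le M X).
Qed.

(** The residual belongs to the set and bounds it, so the join is attained. *)
Lemma ldivmx_starE M X :
  ldivmx (starmx M) X = mxjoin [set Y | lemx Y X /\ lemx (M *m Y) Y].
Proof.
apply: lemx_anti.
  by apply: mxjoin_ge; split; [exact: ldivmx_star_le|exact: mulmx_ldivmx_star_le].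
by apply: mxjoin_le => Y [YX MY]; apply: le_ldivmx_star.
Qed.

End ResidualOfStar.

(** * Bounds of products, stars and residuals of interval matrices *)

Section IntervalMatrix.
Variables (d : Order.disp_t) (S : completeDioidType d).

Lemma lemx_lo_hi n m (X Y : 'M[ivl S]_(n, m)) :
  lemx X Y <-> lemx (lomx X) (lomx Y) /\ lemx (himx X) (himx Y).
Proof.
split=> [XY|[lXY hXY] i j].
  by split=> i j; have := XY i j; rewrite le_ivlE !mxE => /andP[].
by have := lXY i j; have := hXY i j; rewrite !mxE le_ivlE => -> ->.
Qed.

Lemma lomx_le_himx n m (X : 'M[ivl S]_(n, m)) : lemx (lomx X) (himx X).
Proof. by move=> i j; rewrite !mxE; apply: lo_le_hi. Qed.

Definition ivlmx n m (L H : 'M[S]_(n, m)) (LH : lemx L H) : 'M[ivl S]_(n, m) :=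
  \matrix_(i, j) @Ivl d S (L i j, H i j) (LH i j).

Lemma lomx_ivlmx n m (L H : 'M[S]_(n, m)) (LH : lemx L H) :
  lomx (ivlmx LH) = L.
Proof. by apply/matrixP => i j; rewrite !mxE. Qed.

Lemma himx_ivlmx n m (L H : 'M[S]_(n, m)) (LH : lemx L H) :
  himx (ivlmx LH) = H.
Proof. by apply/matrixP => i j; rewrite !mxE. Qed.

Lemma lomx_mul n p m (A : 'M[ivl S]_(n, p)) (X : 'M[ivl S]_(p, m)) :
  lomx (A *m X) = lomx A *m lomx X.
Proof.
apply/matrixP => i j; rewrite !mxE (big_morph (@lo d S) (id1 := 0) (op1 := +%R))//.
by apply: eq_bigr => k _; rewrite !mxE.
Qed.

Lemma himx_mul n p m (A : 'M[ivl S]_(n, p)) (X : 'M[ivl S]_(p, m)) :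
  himx (A *m X) = himx A *m himx X.
Proof.
apply/matrixP => i j; rewrite !mxE (big_morph (@hi d S) (id1 := 0) (op1 := +%R))//.
by apply: eq_bigr => k _; rewrite !mxE.
Qed.

Lemma lomx_exp n (A : 'M[ivl S]_n) k : lomx (A ^+ k) = lomx A ^+ k.
Proof.
elim: k => [|k IH]; last by rewrite !exprS -IH; apply: lomx_mul.
by apply/matrixP => i j; rewrite !expr0 !mxE; case: eqP.
Qed.

Lemma himx_exp n (A : 'M[ivl S]_n) k : himx (A ^+ k) = himx A ^+ k.
Proof.
elim: k => [|k IH]; last by rewrite !exprS -IH; apply: himx_mul.
by apply/matrixP => i j; rewrite !expr0 !mxE; case: eqP.
Qed.

Lemma lo_bigjoin (F : set (ivl S)) : lo (bigjoin F) = bigjoin [set lo x | x in F].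
Proof. by []. Qed.

Lemma hi_bigjoin (F : set (ivl S)) : hi (bigjoin F) = bigjoin [set hi x | x in F].
Proof. by []. Qed.

Lemma lomx_star n (A : 'M[ivl S]_n) : lomx (starmx A) = starmx (lomx A).
Proof.
apply/matrixP => i j; rewrite !mxE lo_bigjoin !image_comp.
by congr bigjoin; apply: eq_imagel => k _ /=; rewrite -lomx_exp mxE.
Qed.

Lemma himx_star n (A : 'M[ivl S]_n) : himx (starmx A) = starmx (himx A).
Proof.
apply/matrixP => i j; rewrite !mxE hi_bigjoin !image_comp.
by congr bigjoin; apply: eq_imagel => k _ /=; rewrite -himx_exp mxE.
Qed.

(** The bounds of a solution lie below [L] and [H] respectively, and its lower bound also lies below
    its upper one; the greatest such pair is the meet of [L] and [H], together with [H]. *)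
Lemma ldivmx_ivl n p m (A : 'M[ivl S]_(n, p)) (X : 'M[ivl S]_(n, m)) :
  lomx (ldivmx A X) =
    meetmx (ldivmx (lomx A) (lomx X)) (ldivmx (himx A) (himx X)) /\
  himx (ldivmx A X) = ldivmx (himx A) (himx X).
Proof.
set L := ldivmx (lomx A) (lomx X); set H := ldivmx (himx A) (himx X).
have leE Y : lemx Y (ldivmx A X) <-> lemx (lomx Y) L /\ lemx (himx Y) H.
  by rewrite -ldivmxP lemx_lo_hi lomx_mul himx_mul !ldivmxP.
have [/= mL mH] := (lemx_meet L H _).1 (lemx_refl _).
(* The candidate with bounds [meetmx L H] and [H] is tested in the Galois connection. *)
have := (leE (ivlmx mH)).2; rewrite lomx_ivlmx himx_ivlmx.
move=> /(_ (conj mL (lemx_refl _))) /lemx_lo_hi.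
rewrite lomx_ivlmx himx_ivlmx => -[leL leH].
have [geL geH] := (leE _).1 (lemx_refl _).
split; apply: lemx_anti => //; apply/lemx_meet; split=> //.
exact: lemx_trans (lomx_le_himx _) geH.
Qed.

End IntervalMatrix.

(** * Bounds of dual products, dual stars and dual residuals *)

Section IntervalDualMatrix.
Variables (d : Order.disp_t) (S : dualDioidType d).

(** The meet of intervals is constructed as a join of lower bounds, so its bounds do not come by
    computation; the interval [z] of meets is shown to equal it. *)
Lemma bounds_meet (x y : ivl S) :
  lo (x `&` y)%O = (lo x `&` lo y)%O /\ hi (x `&` y)%O = (hi x `&` hi y)%O.
Proof.
pose z := @Ivl d S (_, _) (leI2 (lo_le_hi x) (lo_le_hi y)).
suff -> : (x `&` y)%O = z by [].
apply/le_anti; rewrite lexI !le_ivlE !leIl !leIr !lexI /=.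
have := leIl x y; have := leIr y x.
by rewrite !le_ivlE => /andP[-> ->] /andP[-> ->].
Qed.

Lemma lomx_dmul n p m (A : 'M[ivl S]_(n, p)) (X : 'M[ivl S]_(p, m)) :
  lomx (dmulmx A X) = dmulmx (lomx A) (lomx X).
Proof.
apply/matrixP => i j; rewrite !mxE.
rewrite (big_morph (@lo d S) (fun x y => (bounds_meet x y).1) (lo_top S)).
by apply: eq_bigr => k _; rewrite !mxE.
Qed.

Lemma himx_dmul n p m (A : 'M[ivl S]_(n, p)) (X : 'M[ivl S]_(p, m)) :
  himx (dmulmx A X) = dmulmx (himx A) (himx X).
Proof.
apply/matrixP => i j; rewrite !mxE.
rewrite (big_morph (@hi d S) (fun x y => (bounds_meet x y).2) (hi_top S)).
by apply: eq_bigr => k _; rewrite !mxE.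
Qed.

Lemma lomx_dexp n (B : 'M[ivl S]_n) k : lomx (dexpmx B k) = dexpmx (lomx B) k.
Proof.
elim: k => [|k IH]; last by rewrite /dexpmx !iterS lomx_dmul -/(dexpmx B k) IH.
by apply/matrixP => i j; rewrite !mxE; case: eqP => // _; rewrite lo_top.
Qed.

Lemma himx_dexp n (B : 'M[ivl S]_n) k : himx (dexpmx B k) = dexpmx (himx B) k.
Proof.
elim: k => [|k IH]; last by rewrite /dexpmx !iterS himx_dmul -/(dexpmx B k) IH.
by apply/matrixP => i j; rewrite !mxE; case: eqP => // _; rewrite hi_top.
Qed.

Lemma lomx_dstar n (B : 'M[ivl S]_n) : lomx (dstarmx B) = dstarmx (lomx B).
Proof.
apply/matrixP => i j; rewrite !mxE lo_bigmeet !image_comp.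
by congr bigmeet; apply: eq_imagel => k _ /=; rewrite -lomx_dexp mxE.
Qed.

Lemma himx_dstar n (B : 'M[ivl S]_n) : himx (dstarmx B) = dstarmx (himx B).
Proof.
apply/matrixP => i j; rewrite !mxE hi_bigmeet !image_comp.
by congr bigmeet; apply: eq_imagel => k _ /=; rewrite -himx_dexp mxE.
Qed.

(** The bounds of a solution lie above [L] and [H], and its upper bound, being above the lower one,
    also dominates [L]; the least such pair is [L] and [L + H]. *)
Lemma dldivmx_ivl n p m (A : 'M[ivl S]_(n, p)) (X : 'M[ivl S]_(n, m)) :
  lomx (dldivmx A X) = dldivmx (lomx A) (lomx X) /\
  himx (dldivmx A X) =
    dldivmx (lomx A) (lomx X) + dldivmx (himx A) (himx X).
Proof.
set L := dldivmx (lomx A) (lomx X); set H := dldivmx (himx A) (himx X).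
have leE Y : lemx (dldivmx A X) Y <-> lemx L (lomx Y) /\ lemx H (himx Y).
  by rewrite -dldivmxP lemx_lo_hi lomx_dmul himx_dmul !dldivmxP.
have [/= Lj Hj] := (lemx_add L H _).1 (lemx_refl _).
have := (leE (ivlmx Lj)).2; rewrite lomx_ivlmx himx_ivlmx.
move=> /(_ (conj (lemx_refl _) Hj)) /lemx_lo_hi.
rewrite lomx_ivlmx himx_ivlmx => -[leL leH].
have [geL geH] := (leE _).1 (lemx_refl _).
split; apply: lemx_anti => //; apply/lemx_add; split=> //.
exact: lemx_trans geL (lomx_le_himx _).
Qed.

End IntervalDualMatrix.

Theorem proposition63 (d : Order.disp_t) (S : dualDioidType d) (n m : nat)
    (A B : 'M[ivl S]_n) :
  (forall X : 'M[ivl S]_(n, m),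
     dldivmx (dstarmx B) (starmx A *m X) =
     dldivmx (dstarmx B) (starmx A) *m X) ->
  let P := fun X : 'M[ivl S]_(n, m) =>
    ldivmx (starmx (dldivmx (dstarmx B) (starmx A))) X in
  let U : 'M[S]_n := dldivmx (dstarmx (lomx B)) (starmx (lomx A)) in
  let V : 'M[S]_n := dldivmx (dstarmx (himx B)) (starmx (himx A)) in
  let K : set 'M[ivl S]_(n, m) :=
    range (fun X : 'M[ivl S]_(n, m) => starmx A *m X) `&`
    range (fun X : 'M[ivl S]_(n, m) => dmulmx (dstarmx B) X) in
  [/\ forall X : 'M[ivl S]_(n, m),
        lomx (P X) = meetmx (ldivmx (starmx U) (lomx X))
                            (ldivmx (starmx (U + V)) (himx X)) /\
        himx (P X) = ldivmx (starmx (U + V)) (himx X),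
      forall X : 'M[ivl S]_(n, m), P (P X) = P X,
      forall X : 'M[ivl S]_(n, m), K (P X) &
      forall X : 'M[ivl S]_(n, m),
        P X = mxjoin [set Y | lemx Y X /\ K Y]].
Proof.
move=> BA P U V K; pose M := dldivmx (dstarmx B) (starmx A).
have KE Y : K Y <-> lemx (M *m Y) Y.
  (* The assumed equality, read from right to left, turns [M *m Y] into the dual residual of
     [starmx A *m Y]. *)
  rewrite -BA dldivmx_star_leE; split=> [] [AY BY].
    by split; [apply/range_starmxE|apply/range_dstarmxE].
  by split; [apply/range_starmxE|apply/range_dstarmxE].
have [loM hiM] : lomx M = U /\ himx M = U + V.
  (* Stars of bounds become bounds of stars, so that [U] and [V] are the two residuals in
     [dldivmx_ivl]. *)
  rewrite /U /V -lomx_dstar -himx_dstar -lomx_star -himx_star.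
  exact: dldivmx_ivl.
split=> X.
- have := ldivmx_ivl (starmx M) X.
  by rewrite lomx_star himx_star loM hiM.
- exact: ldivmx_star_idem.
- exact/KE/mulmx_ldivmx_star_le.
(* The two joins range over the same set, since [KE] identifies [K] with the solutions of
   [lemx (M *m Y) Y]. *)
- rewrite [P X]ldivmx_starE; congr mxjoin; apply/seteqP.
  by split=> Y /= [YX /KE KY].
Qed.
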